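(* Let $X=\bigcup_{i=1}^r X_{w_i}^{v_i}$ be a finite union of Richardson varieties in $G_{d,n}$ (where $w_i,v_i\in I_{d,n}$, $w_i\ge v_i$), and let $S$ be the homogeneous coordinate ring of $X$ for the Plücker embedding. Then the standard monomials on $X$ form a $K$-basis of $S$.
   Context: $K$ is an algebraically closed field of arbitrary characteristic, $1\le d<n$, and $G_{d,n}$ is the Grassmannian of $d$-dimensional subspaces of $K^n$, embedded in $\mathbb{P}(\wedge^d K^n)$ by the Plücker embedding. $I_{d,n}=\{(i_1,\dots,i_d)\in\mathbb{N}^d: 1\le i_1<\dots<i_d\le n\}$, partially ordered by $\underline i\ge\underline j\iff i_t\ge j_t$ for all $t$. For $\underline i\in I_{d,n}$, $p_{\underline i}$ is the Plücker coordinate (if $U$ is the column span of an $n\times d$ matrix $A$, $p_{\underline i}(U)$ is the minor of $A$ on rows $i_1,\dots,i_d$). With $V_t=\langle e_1,\dots,e_t\rangle$ and $V^t=\langle e_n,\dots,e_{n-t+1}\rangle$, the Schubert variety is $X_{\underline i}=\{U: \dim(U\cap V_{i_t})\ge t,\ 1\le t\le d\}$ and the opposite Schubert variety is $X^{\underline i}=\{U:\dim(U\cap V^{n-i_{(d-t+1)}+1})\ge t,\ 1\le t\le d\}$. The Richardson variety is $X_w^v=X_w\cap X^v$; it is nonempty iff $w\ge v$, and then it is a reduced irreducible closed subvariety of $G_{d,n}$. A monomial $p_{\tau_1}\cdots p_{\tau_m}$ (with $\tau_i\in I_{d,n}$) is standard if $\tau_1\ge\cdots\ge\tau_m$; it is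 standard on $X_w^v$ if moreover $w\ge\tau_1$ and $\tau_m\ge v$. A monomial in the Plücker coordinates is standard on a union $X=\bigcup X_i$ of Richardson varieties if it is standard on some $X_i$. *)

(* Defs.v *)
(* Built on MathComp, with multinomials for the polynomial ring and the        *)
(* classical boolp layer to turn membership in an ideal into a boolean.        *)
From HB Require Import structures.
From mathcomp Require Import all_boot all_order all_algebra.
From mathcomp Require Import boolp.
From mathcomp Require Import mpoly.

Set Implicit Arguments.
Unset Strict Implicit.
Unset Printing Implicit Defensive.

Import GRing.Theory.

Local Open Scope ring_scope.
Local Open Scope quotient_scope.

(* Indices are 0-based throughout: the i-th entry of a tuple stands for        *)
(* (the (i+1)-st entry of the mathematical tuple) - 1, and row j : 'I_n of a   *)
(* matrix stands for row j+1.                                                  *)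
Definition Idn (d n : nat) :=
  {t : d.-tuple 'I_n | sorted ltn (map val (val t))}.

Definition entry d n (s : Idn d n) (k : 'I_d) : 'I_n := tnth (val s) k.

Definition leI d n (s t : Idn d n) : bool :=
  [forall k : 'I_d, (entry s k <= entry t k)%N].

Definition geI d n (s t : Idn d n) : bool := leI t s.

Section Varieties.
Variables (K : fieldType) (d n : nat).
Implicit Types (U : {vspace 'cV[K]_n}) (w v : Idn d n).

(* V_t = <e_1, ..., e_t>. *)
Definition Vlow (t : nat) : {vspace 'cV[K]_n} :=
  <<[seq (delta_mx j 0%R : 'cV[K]_n) | j : 'I_n <- enum 'I_n & (j < t)%N]>>%VS.

(* V^t = <e_n, ..., e_(n-t+1)>. *)
Definition Vupp (t : nat) : {vspace 'cV[K]_n} :=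
  <<[seq (delta_mx j 0%R : 'cV[K]_n) | j : 'I_n <- enum 'I_n & (n - t <= j)%N]>>%VS.

Definition Grassmannian : pred {vspace 'cV[K]_n} := [pred U | \dim U == d].

(* dim (U n V_(i_t)) >= t for 1 <= t <= d, with t = k + 1. *)
Definition Schubert w : pred {vspace 'cV[K]_n} :=
  [pred U | Grassmannian U &&
    [forall k : 'I_d, (k.+1 <= \dim (U :&: Vlow (entry w k).+1))%N]].

(* dim (U n V^(n - i_(d-t+1) + 1)) >= t for 1 <= t <= d, with t = k + 1: the   *)
(* 1-based position d - t + 1 is the 0-based position rev_ord k, and the shift *)
(* of the entry absorbs the + 1.                                               *)
Definition opp_Schubert v : pred {vspace 'cV[K]_n} :=
  [pred U | Grassmannian U &&
    [forall k : 'I_d,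
       (k.+1 <= \dim (U :&: Vupp (n - entry v (rev_ord k))))%N]].

Definition Richardson w v : pred {vspace 'cV[K]_n} :=
  [pred U | Schubert w U && opp_Schubert v U].

Definition union_Richardson (r : nat) (w v : 'I_r -> Idn d n) :
    pred {vspace 'cV[K]_n} :=
  [pred U | [exists i : 'I_r, Richardson (w i) (v i) U]].

Definition colspan (A : 'M[K]_(n, d)) : {vspace 'cV[K]_n} :=
  <<[seq col k A | k <- enum 'I_d]>>%VS.

Definition plucker (A : 'M[K]_(n, d)) (s : Idn d n) : K :=
  \det (rowsub (entry s) A).

Local Notation plucker_ring := {mpoly K[#|{: Idn d n}|]}.

Definition plucker_var (s : Idn d n) : plucker_ring := 'X_(enum_rank s).

(* As A ranges over all matrices with column span U, the vectors of Pluecker   *)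
(* coordinates of A range over all the homogeneous coordinate vectors of the   *)
(* point U of projective space: changing the basis of U by g multiplies them   *)
(* by det g. So f belongs to the ideal iff it vanishes at every vector of      *)
(* homogeneous coordinates of every point of X.                                *)
Definition vanishing_ideal (X : pred {vspace 'cV[K]_n}) : pred plucker_ring :=
  fun f => `[< forall U, Grassmannian U -> X U ->
                 forall A : 'M[K]_(n, d), colspan A = U ->
                   f.@[fun k => plucker A (enum_val k)] = 0 >].

Section CoordRing.
Variable X : pred {vspace 'cV[K]_n}.
Local Notation I := (vanishing_ideal X).

Fact vanishing_zmod_closed : zmod_closed I.
Proof.
split; first by apply/asboolP => U _ _ A _; rewrite meval0.
move=> f g /asboolP Hf /asboolP Hg; apply/asboolP => U GU XU A AU.
by rewrite mevalB (Hf U) // (Hg U) // subr0.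
Qed.

HB.instance Definition _ :=
  GRing.isZmodClosed.Build plucker_ring (vanishing_ideal X)
    vanishing_zmod_closed.

Definition vanishing_zmod : zmodClosed plucker_ring :=
  HB.pack (vanishing_ideal X)
    (GRing.isZmodClosed.Build plucker_ring (vanishing_ideal X)
       vanishing_zmod_closed).

Fact vanishing_idealM (f g : plucker_ring) : g \in I -> f * g \in I.
Proof.
move=> /asboolP Hg; apply/asboolP => U GU XU A AU.
by rewrite mevalM (Hg U) // mulr0.
Qed.

(* The library only puts a ring structure on the quotient by a proper ideal;   *)
(* here X may be empty, so the structure is built on the additive quotient.    *)
Definition coord_ring : Type := {ideal_quot vanishing_zmod}.

HB.instance Definition _ := GRing.Zmodule.on coord_ring.

Definition to_coord_ring : plucker_ring -> coord_ring :=
  \pi_{ideal_quot vanishing_zmod}.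

Fact to_coord_ring_surj (x : coord_ring) : exists f, to_coord_ring f = x.
Proof. by exists (repr x); rewrite /to_coord_ring reprK. Qed.

Fact to_coord_ring_eq f g : to_coord_ring f = to_coord_ring g <-> f - g \in I.
Proof.
have -> : (f - g \in I) = (to_coord_ring f == to_coord_ring g).
  exact: (Quotient.idealrBE vanishing_zmod f g).
by split=> /eqP.
Qed.

Fact to_coord_ring_zmod : zmod_morphism to_coord_ring.
Proof. by move=> f g; rewrite /to_coord_ring raddfB. Qed.

HB.instance Definition _ :=
  GRing.isZmodMorphism.Build plucker_ring coord_ring to_coord_ring
    to_coord_ring_zmod.

Definition coord_rep (x : coord_ring) : plucker_ring :=
  repr (x : {ideal_quot vanishing_zmod}).

Fact coord_repK : cancel coord_rep to_coord_ring.
Proof. by move=> x; rewrite /to_coord_ring reprK. Qed.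

Definition coord_one : coord_ring := to_coord_ring 1.
Definition coord_mul (x y : coord_ring) : coord_ring :=
  to_coord_ring (coord_rep x * coord_rep y).
Definition coord_scale (c : K) (x : coord_ring) : coord_ring :=
  to_coord_ring (c *: coord_rep x).

Fact coord_mulE f g :
  coord_mul (to_coord_ring f) (to_coord_ring g) = to_coord_ring (f * g).
Proof.
apply/to_coord_ring_eq.
set f' := coord_rep _; set g' := coord_rep _.
have Hf : f' - f \in I by apply/to_coord_ring_eq; exact: coord_repK.
have Hg : g' - g \in I by apply/to_coord_ring_eq; exact: coord_repK.
have -> : f' * g' - f * g = g' * (f' - f) + f * (g' - g).
  by rewrite !mulrBr addrA (mulrC g' f) subrK (mulrC g').
by rewrite rpredD // vanishing_idealM.
Qed.

Fact coord_scaleE c f :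
  coord_scale c (to_coord_ring f) = to_coord_ring (c *: f).
Proof.
apply/to_coord_ring_eq; rewrite -scalerBr -mul_mpolyC vanishing_idealM //.
by apply/to_coord_ring_eq; exact: coord_repK.
Qed.

Fact coord_mulA : associative coord_mul.
Proof.
move=> x y z; have [f <-] := to_coord_ring_surj x.
have [g <-] := to_coord_ring_surj y; have [h <-] := to_coord_ring_surj z.
by rewrite !coord_mulE mulrA.
Qed.

Fact coord_mulC : commutative coord_mul.
Proof. by move=> x y; rewrite /coord_mul mulrC. Qed.

Fact coord_mul1 : left_id coord_one coord_mul.
Proof.
by move=> x; have [f <-] := to_coord_ring_surj x; rewrite coord_mulE mul1r.
Qed.

Fact coord_mulDl : left_distributive coord_mul +%R.
Proof.
move=> x y z; have [f <-] := to_coord_ring_surj x.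
have [g <-] := to_coord_ring_surj y; have [h <-] := to_coord_ring_surj z.
by rewrite !coord_mulE -!raddfD coord_mulE mulrDl.
Qed.

HB.instance Definition _ :=
  GRing.Zmodule_isComPzRing.Build coord_ring
    coord_mulA coord_mulC coord_mul1 coord_mulDl.

Fact to_coord_ring_monoid : monoid_morphism to_coord_ring.
Proof. by split=> // f g; rewrite -coord_mulE. Qed.

HB.instance Definition _ :=
  GRing.isMonoidMorphism.Build plucker_ring coord_ring to_coord_ring
    to_coord_ring_monoid.

Fact coord_scaleA a b x :
  coord_scale a (coord_scale b x) = coord_scale (a * b) x.
Proof.
have [f <-] := to_coord_ring_surj x.
by rewrite !coord_scaleE scalerA.
Qed.

Fact coord_scale1 : left_id 1 coord_scale.
Proof.
by move=> x; have [f <-] := to_coord_ring_surj x; rewrite coord_scaleE scale1r.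
Qed.

Fact coord_scaleDr : right_distributive coord_scale +%R.
Proof.
move=> a x y; have [f <-] := to_coord_ring_surj x.
have [g <-] := to_coord_ring_surj y.
by rewrite -raddfD !coord_scaleE scalerDr raddfD.
Qed.

Fact coord_scaleDl x : {morph coord_scale^~ x : a b / a + b}.
Proof.
move=> a b; have [f <-] := to_coord_ring_surj x.
by rewrite !coord_scaleE scalerDl raddfD.
Qed.

HB.instance Definition _ :=
  GRing.Zmodule_isLmodule.Build K coord_ring
    coord_scaleA coord_scale1 coord_scaleDr coord_scaleDl.

Fact to_coord_ring_scalable : scalable to_coord_ring.
Proof. by move=> c f; rewrite -coord_scaleE. Qed.

HB.instance Definition _ :=
  GRing.isScalable.Build K plucker_ring coord_ring *:%R to_coord_ring
    to_coord_ring_scalable.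

Fact coord_scaleAl (a : K) (x y : coord_ring) : a *: (x * y) = (a *: x) * y.
Proof.
have [f <-] := to_coord_ring_surj x; have [g <-] := to_coord_ring_surj y.
by rewrite -[in RHS]linearZ -!rmorphM -linearZ scalerAl.
Qed.

Definition plucker_coord (s : Idn d n) : coord_ring :=
  to_coord_ring (plucker_var s).

(* The monomial p_(tau_1) ... p_(tau_m) for s = [:: tau_1; ...; tau_m].        *)
Definition plucker_monomial (s : seq (Idn d n)) : coord_ring :=
  \prod_(tau <- s) plucker_coord tau.

End CoordRing.
End Varieties.

Arguments union_Richardson K {d n r} w v.

(* Since geI is antisymmetric, a standard monomial is represented by exactly   *)
(* one sequence, its decreasing list of factors; standard monomials are        *)
(* therefore indexed by the standard sequences. The empty sequence represents  *)
(* the monomial 1.                                                             *)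
Definition standard d n (s : seq (Idn d n)) : bool := sorted (@geI d n) s.

Definition standard_on d n (w v : Idn d n) (s : seq (Idn d n)) : bool :=
  standard s &&
  (if s is tau1 :: s' then geI w tau1 && geI (last tau1 s') v else true).

Definition standard_on_union d n r (w v : 'I_r -> Idn d n)
    (s : seq (Idn d n)) : bool :=
  [exists i : 'I_r, standard_on (w i) (v i) s].

(* The family of the b t, for t satisfying P, is a K-basis of V (possibly of   *)
(* infinite dimension); members with distinct indices count as distinct.       *)
Definition is_basis (K : fieldType) (V : lmodType K) (T : eqType)
    (P : pred T) (b : T -> V) : Prop :=
  (forall (ts : seq T) (c : T -> K), uniq ts -> all P ts ->
     \sum_(t <- ts) c t *: b t = 0 -> forall t, t \in ts -> c t = 0)
  /\ (forall x : V, exists (ts : seq T) (c : T -> K),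
        all P ts /\ x = \sum_(t <- ts) c t *: b t).

(* Main.v *)
Require Import Defs.
From HB Require Import structures.
From mathcomp Require Import all_boot all_order all_algebra.
From mathcomp Require Import fingroup perm.
From mathcomp Require Import boolp.
From mathcomp Require Import mpoly.
From mathcomp Require Import zify.

Set Implicit Arguments.
Unset Strict Implicit.
Unset Printing Implicit Defensive.

Import GRing.Theory.
Local Open Scope ring_scope.

(* Spanning: if a_k < b_k, distribute the d + 1 rows a_1 < ... < a_k < b_k < ...
   < b_d of a matrix over the two minors p_a and p_b in all possible ways; the
   alternating sum of the resulting products vanishes, and every term other than
   p_a p_b has a first factor with a larger sum of indices. Iterating rewrites
   any monomial into standard ones. A standard monomial that is not standard on
   X_w^v has a factor vanishing on X_w^v.

   Independence: a matrix whose entries (j, k) vanish unless v_k <= j <= w_k has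
   its column span in X_w^v as soon as it has rank d. For entries t^(B^(j d + k))
   the minor p_a with v <= a <= w is monic in t, its leading term being the
   diagonal one, and the exponent of the leading term of a standard monomial
   determines, through its base-B digits, the content of each column of the
   corresponding tableau. Distinct standard monomials on X_w^v thus restrict to
   monic polynomials of distinct degrees. On a union, restrict to each X_i. *)

(** * Expansion, vanishing and splitting of determinants *)

Section Determinants.
Variable R : comNzRingType.

(** Multilinearity in the rows: each row independently picks one of the summands. *)
Lemma det_row_sum m (T : finType) (r : T -> 'M[R]_m) :
  \det (\sum_b r b) =
  \sum_(f : {ffun 'I_m -> T}) \det (\matrix_(i, j) r (f i) i j).
Proof.
rewrite /determinant exchange_big; apply: eq_bigr => s _ /=.
rewrite -mulr_sumr; congr (_ * _).
under eq_bigr do rewrite summxE.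
rewrite bigA_distr_bigA; apply: eq_bigr => f _.
by apply: eq_bigr => i _; rewrite mxE.
Qed.

(** Pigeonhole: no permutation maps [P] into the smaller set [Q], so every term of the expansion
    contains a zero entry. *)
Lemma det0_support m (M : 'M[R]_m) (P Q : {set 'I_m}) : (#|Q| < #|P|)%N ->
  (forall i j, i \in P -> j \notin Q -> M i j = 0) -> \det M = 0.
Proof.
move=> ltQP M0; rewrite /determinant big1 // => s _.
have [i Pi nQsi] : exists2 i, i \in P & s i \notin Q.
  apply/exists_inP; rewrite -negb_forall_in; apply: contraL ltQP => /forall_inP PQ.
  rewrite -leqNgt -(card_imset _ (@perm_inj _ s)); apply: subset_leq_card.
  by apply/subsetP => _ /imsetP[i Pi ->]; rewrite PQ.
by rewrite (bigD1 i) //= M0 // mul0r mulr0.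
Qed.

(** Listing the rows of [P] first makes [N] block diagonal. The sign is that of this reordering, so
    one [b] serves all [N]. *)
Lemma det_split_rows m (P : {set 'I_(m + m)}) (e e' : 'I_m -> 'I_(m + m)) :
  injective e -> injective e' ->
  (forall i, e i \in P) -> (forall i, e' i \notin P) ->
  exists b : bool, forall N : 'M[R]_(m + m),
    (forall i j, i \in P -> N i (rshift m j) = 0) ->
    (forall i j, i \notin P -> N i (lshift m j) = 0) ->
    \det N = (-1) ^+ b * \det (\matrix_(i, j) N (e i) (lshift m j))
                       * \det (\matrix_(i, j) N (e' i) (rshift m j)).
Proof.
move=> inj_e inj_e' Pe nPe'.
pose h i := match split i with inl a => e a | inr a => e' a end.
have inj_h : injective h.
  move=> i j; rewrite /h.
  case: (split_ordP i) => a ->; case: (split_ordP j) => c -> E.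
  - by rewrite (inj_e _ _ E).
  - by have := nPe' c; rewrite -E Pe.
  - by have := nPe' a; rewrite E Pe.
  - by rewrite (inj_e' _ _ E).
pose s := perm inj_h; exists (odd_perm s) => N N0 N0'.
have -> : \det N = (-1) ^+ s * \det (row_perm s N).
  by rewrite row_permE det_mulmx det_perm mulrA -signr_addb addbb mul1r.
rewrite -mulrA; congr (_ * _); rewrite -(det_ublock _ 0); congr (\det _).
apply/matrixP => i j; rewrite !mxE permE /h.
case: (split_ordP i) => a _; case: (split_ordP j) => c ->.
- by rewrite row_mxEl mxE.
- by rewrite row_mxEr mxE N0.
- by rewrite row_mxEl mxE N0'.
- by rewrite row_mxEr mxE.
Qed.

End Determinants.

(** * Minors on arbitrary lists of rows *)

Section Minors.
Variables (K : fieldType) (d n : nat).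

Definition weight (s : Idn d n) := (\sum_(k < d) entry s k)%N.

Lemma entry_lt (s : Idn d n) (k l : 'I_d) :
  (k < l)%N -> (entry s k < entry s l)%N.
Proof.
move=> ltkl; have srt := valP s.
have /= := sorted_ltn_nth ltn_trans 0%N srt k l.
rewrite !inE !size_map size_tuple !ltn_ord.
move=> /(_ isT isT ltkl).
have E (i : 'I_d) : nth 0%N [seq val x | x <- val (val s)] i = entry s i.
  by rewrite (nth_map (entry s i)) ?size_tuple // -tnth_nth.
by rewrite !E.
Qed.

Lemma entry_le (s : Idn d n) (k l : 'I_d) :
  (k <= l)%N -> (entry s k <= entry s l)%N.
Proof.
by rewrite leq_eqVlt => /predU1P[/val_inj->|/entry_lt/ltnW].
Qed.

(** A repeated row gives zero; otherwise sorting the rows changes only the sign. The index [s] and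
    the sign are chosen before [A], so the identity is uniform in [A]. *)
Lemma minor_sort (g : 'I_d -> 'I_n) :
  (forall A : 'M[K]_(n, d), \det (rowsub g A) = 0) \/
  exists (s : Idn d n) (b : bool),
    weight s = (\sum_(k < d) g k)%N /\
    forall A : 'M[K]_(n, d), \det (rowsub g A) = (-1) ^+ b * plucker A s.
Proof.
have [inj_g | /injectivePn[i [j neq_ij eq_g]]] := boolP (injectiveb g); last first.
  left=> A; apply: (determinant_alternate neq_ij) => k.
  by rewrite !mxE eq_g.
right; set t := [tuple g k | k < d].
pose leg (x y : 'I_n) := (x <= y)%N.
have leg_tr : transitive leg by move=> y x z; exact: leq_trans.
have leg_tot : total leg by move=> x y; exact: leq_total.
pose u := [tuple of sort leg t].
have su : sorted ltn (map val u).
  rewrite ltn_sorted_uniq_leq (map_inj_uniq val_inj) sort_uniq sorted_map.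
  rewrite (map_inj_uniq (injectiveP _ inj_g)) enum_uniq /=.
  exact: (sort_sorted leg_tot).
have /tuple_permP[p Ep] : perm_eq u t by rewrite perm_sort.
have Eu k : tnth u k = g (p k).
  have -> : u = [tuple tnth t (p i) | i < d] by apply: val_inj.
  by rewrite !tnth_mktuple.
pose s : Idn d n := exist _ u su.
have Es k : entry s k = g (p k) by rewrite -Eu.
exists s, (odd_perm p); split.
  rewrite [RHS](reindex_inj (@perm_inj _ p)); apply: eq_bigr => k _ /=.
  by rewrite Es.
move=> A; rewrite /plucker.
have -> : rowsub (entry s) A = row_perm p (rowsub g A).
  by apply/matrixP => k l; rewrite !mxE Es.
by rewrite row_permE det_mulmx det_perm mulrA -signr_addb addbb mul1r.
Qed.

End Minors.

(** * The quadratic straightening relation *)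

Section Straightening.
Variables (K : fieldType) (d n : nat).

(** [det_split_rows] followed by [minor_sort] on each half. If a half repeats a row, the coefficient
    is 0 and [s0] fills the slots; hence the guard [c != 0] on the weights. *)
Lemma minor_pair (s0 : Idn d n) (z : 'I_(d + d) -> 'I_n) (P : {set 'I_(d + d)}) :
  #|P| = d ->
  exists (c : K) (a b : Idn d n),
    (c != 0 -> weight a = (\sum_(i in P) z i)%N /\
               weight b = (\sum_(i in ~: P) z i)%N) /\
    forall (N : 'M[K]_(d + d)) (A : 'M[K]_(n, d)),
      (forall i j, N i (lshift d j) = if i \in P then A (z i) j else 0) ->
      (forall i j, N i (rshift d j) = if i \in P then 0 else A (z i) j) ->
      \det N = c * (plucker A a * plucker A b).
Proof.
move=> cP; have cP' : #|~: P| = d by rewrite cardsCs setCK card_ord cP addnK.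
pose e k := enum_val (cast_ord (esym cP) k).
pose e' k := enum_val (cast_ord (esym cP') k).
have Pe k : e k \in P by exact: enum_valP.
have P'e' k : e' k \notin P by rewrite -in_setC; exact: enum_valP.
have sum_e : (\sum_(i in P) z i = \sum_k z (e k))%N.
  rewrite big_enum_val (reindex (cast_ord (esym cP))) //.
  by exists (cast_ord cP) => i _; rewrite ?cast_ordK ?cast_ordKV.
have sum_e' : (\sum_(i in ~: P) z i = \sum_k z (e' k))%N.
  rewrite big_enum_val (reindex (cast_ord (esym cP'))) //.
  by exists (cast_ord cP') => i _; rewrite ?cast_ordK ?cast_ordKV.
have [||sg detN] := @det_split_rows K d P e e' _ _ Pe P'e'.
- by move=> i j /enum_val_inj/cast_ord_inj.
- by move=> i j /enum_val_inj/cast_ord_inj.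
have {}detN (N : 'M[K]_(d + d)) (A : 'M[K]_(n, d)) :
    (forall i j, N i (lshift d j) = if i \in P then A (z i) j else 0) ->
    (forall i j, N i (rshift d j) = if i \in P then 0 else A (z i) j) ->
    \det N = (-1) ^+ sg * \det (rowsub (z \o e) A) * \det (rowsub (z \o e') A).
  move=> Nl Nr; rewrite detN => [|i j Pi|i j nPi]; last 2 first.
  - by rewrite Nr Pi.
  - by rewrite Nl (negPf nPi).
  congr (_ * _ * _); congr (\det _); apply/matrixP => i j; rewrite !mxE.
    by rewrite Nl Pe.
  by rewrite Nr (negPf (P'e' i)).
case: (@minor_sort K _ _ (z \o e)) => [det0|[a [sa [wa deta]]]].
  exists 0, s0, s0; split=> [|N A Nl Nr]; first by rewrite eqxx.
  by rewrite (detN N A Nl Nr) det0 mulr0 !mul0r.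
case: (@minor_sort K _ _ (z \o e')) => [det0|[b [sb [wb detb]]]].
  exists 0, s0, s0; split=> [|N A Nl Nr]; first by rewrite eqxx.
  by rewrite (detN N A Nl Nr) det0 mulr0 mul0r.
exists ((-1) ^+ sg * (-1) ^+ sa * (-1) ^+ sb), a, b; split=> [_|N A Nl Nr].
  by rewrite wa wb sum_e sum_e'.
by rewrite (detN N A Nl Nr) deta detb -!mulrA; do 2!congr (_ * _); rewrite mulrCA.
Qed.


(* The (d + 1) doubled rows of the block matrix [row_mx (ML A) (MR A)] lie in the
   diagonal of K^d + K^d, so its determinant is zero; expanding each doubled row
   z as (z, 0) + (0, z) gives the relation, without any sign bookkeeping. *)
Lemma straighten_pair (a b : Idn d n) : ~~ geI a b ->
  exists (T : finType) (c : T -> K) (a' b' : T -> Idn d n),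
    (forall f, c f != 0 -> (weight a < weight (a' f))%N /\
       (weight (a' f) + weight (b' f) = weight a + weight b)%N) /\
    forall A : 'M[K]_(n, d), plucker A a * plucker A b =
      \sum_f c f * (plucker A (a' f) * plucker A (b' f)).
Proof.
rewrite /geI /leI => /forallPn[k]; rewrite -ltnNge => lt_ab.
pose z (i : 'I_(d + d)) := match split i with inl l => entry a l | inr l => entry b l end.
pose home (i : 'I_(d + d)) : bool := if split i is inl _ then true else false.
pose dbl (i : 'I_(d + d)) :=
  match split i with inl l => (l <= k)%N | inr l => (k <= l)%N end.
(* [true] stands for the left copy of K^d, where the rows of [a] start, and [false] for the right
   copy, where those of [b] start. A doubled row may go to either copy, any other row only to its
   own. *)
pose ok i (s : bool) := (s == home i) || dbl i.
pose ML (A : 'M[K]_(n, d)) : 'M[K]_(d + d, d) :=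
  \matrix_(i, j) if ok i true then A (z i) j else 0.
pose MR (A : 'M[K]_(n, d)) : 'M[K]_(d + d, d) :=
  \matrix_(i, j) if ok i false then A (z i) j else 0.
pose r A (s : bool) : 'M[K]_(d + d) := if s then row_mx (ML A) 0 else row_mx 0 (MR A).
pose N A (f : {ffun 'I_(d + d) -> bool}) := \matrix_(i, j) r A (f i) i j.
have home_l l : home (lshift d l) = true by rewrite /home (unsplitK (inl _ l)).
have home_r l : home (rshift d l) = false by rewrite /home (unsplitK (inr _ l)).
have z_l l : z (lshift d l) = entry a l by rewrite /z (unsplitK (inl _ l)).
have z_r l : z (rshift d l) = entry b l by rewrite /z (unsplitK (inr _ l)).
have dbl_l l : dbl (lshift d l) = (l <= k)%N by rewrite /dbl (unsplitK (inl _ l)).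
have dbl_r l : dbl (rshift d l) = (k <= l)%N by rewrite /dbl (unsplitK (inr _ l)).
have card_split (F : 'I_(d + d) -> bool) :
    #|[set i | F i]| = (\sum_(l < d) (F (lshift d l) + F (rshift d l)))%N.
  rewrite cardsE -sum1_card big_mkcond big_split_ord /= -big_split /=.
  by apply: eq_bigr => l _; rewrite !unfold_in; do 2!case: (F _).
have card_home : #|[set i | home i]| = d.
  rewrite card_split -[RHS]card_ord -sum1_card.
  by apply: eq_bigr => l _; rewrite home_l home_r.
have card_dbl : #|[set i | dbl i]| = d.+1.
  rewrite card_split (eq_bigr (fun l : 'I_d => 1 + (l == k))%N) => [|l _].
    rewrite big_split /= sum1_card card_ord -addn1 (bigD1 k) //= eqxx big1 //.
    by move=> l /negPf->.
  by rewrite dbl_l dbl_r -val_eqE /=; case: ltngtP.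
have det0 A : \sum_f \det (N A f) = 0.
  rewrite -det_row_sum big_bool /= add_row_mx addr0 add0r.
  (* Right multiplication by [U] subtracts the left half of the columns from the right half. The
     [d + 1] doubled rows are then supported in the [d] left columns. *)
  pose U : 'M[K]_(d + d) := block_mx 1%:M (- 1%:M) 0 1%:M.
  have detU : \det U = 1 by rewrite det_ublock !det1 mulr1.
  rewrite -[LHS]mulr1 -detU -det_mulmx mul_row_block !mulmx1 mulmx0 addr0.
  apply: (@det0_support _ _ _ [set i | dbl i] [set i | home i]).
    by rewrite card_home card_dbl.
  move=> i j; rewrite !inE; case: (split_ordP j) => l ->; rewrite ?home_l //.
  move=> di _; rewrite row_mxEr mulmxN mulmx1 !mxE /ok di !orbT addrC subrr //.
(* Every distribution [f] gets a triple, with coefficient 0 in the degenerate cases, so that finite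
   choice yields the three families. The distribution [home] is set aside: it gives p_a p_b. *)
have termP (f : {ffun 'I_(d + d) -> bool}) : exists (x : K * (Idn d n * Idn d n)),
   (x.1 != 0 -> (weight a < weight x.2.1)%N /\
       (weight x.2.1 + weight x.2.2 = weight a + weight b)%N) /\
   forall A, (if f == finfun home then 0 else - \det (N A f)) =
     x.1 * (plucker A x.2.1 * plucker A x.2.2).
  have [_|neq_f] := eqVneq f (finfun home).
    by exists (0, (a, b)); split=> [|A]; rewrite ?eqxx ?mul0r.
  have triv : (forall A, \det (N A f) = 0) -> exists x : K * (Idn d n * Idn d n),
      (x.1 != 0 -> (weight a < weight x.2.1)%N /\
        (weight x.2.1 + weight x.2.2 = weight a + weight b)%N) /\
      forall A, - \det (N A f) = x.1 * (plucker A x.2.1 * plucker A x.2.2).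
    move=> N0; by exists (0, (a, b)); split=> [|A]; rewrite ?eqxx ?N0 ?mul0r ?oppr0.
  have Nl A i l : N A f i (lshift d l) = if f i && ok i true then A (z i) l else 0.
    by rewrite mxE /r; case: (f i); rewrite row_mxEl mxE.
  have Nr A i l : N A f i (rshift d l) = if ~~ f i && ok i false then A (z i) l else 0.
    by rewrite mxE /r; case: (f i); rewrite row_mxEr mxE.
  (* A row sent to a copy that it may not enter becomes a zero row. *)
  have [/forallP okf | /forallPn[i nok]] := boolP [forall i, ok i (f i)]; last first.
    apply: triv => A; apply: (@det0_support _ _ _ [set i] set0).
      by rewrite cards0 cards1.
    move=> _ j /set1P-> _; case: (split_ordP j) => l ->; rewrite ?Nl ?Nr.
      by case: (f i) nok => //= /negPf->.
    by case: (f i) nok => //= /negPf->.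
  set P := [set i | f i].
  (* An unbalanced distribution puts more than [d] rows into [d] columns. *)
  case: (ltngtP #|P| d) => cP.
  - apply: triv => A; apply: (@det0_support _ _ _ (~: P) (~: [set i | home i])).
      rewrite -(ltn_add2l #|[set i | home i]|) cardsC card_home -(cardsC P).
      by rewrite ltn_add2r.
    move=> i j; rewrite !inE negbK; case: (split_ordP j) => l ->; rewrite ?home_r //.
    by rewrite Nl => /negPf->.
  - apply: triv => A; apply: (@det0_support _ _ _ P [set i | home i]).
      by rewrite card_home.
    move=> i j; rewrite !inE; case: (split_ordP j) => l ->; rewrite ?home_l //.
    by rewrite Nr => ->.
  have [c [a' [b' [wab detN]]]] := minor_pair a z cP.
  exists (- c, (a', b')); rewrite oppr_eq0; split=> [/wab[-> ->]|A] /=; last first.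
    rewrite (detN _ A) ?mulNr // => i j; rewrite ?Nl ?Nr inE; have := okf i.
      by case: (f i) => // ->.
    by case: (f i) => // ->.
  have sum_home (F : 'I_(d + d) -> nat) :
      (\sum_(i in [set i | home i]) F i = \sum_(l < d) F (lshift d l))%N.
    rewrite big_mkcond big_split_ord /= [X in (_ + X)%N]big1 ?addn0 => [|l _].
      by apply: eq_bigr => l _; rewrite inE home_l.
    by rewrite inE home_r.
  have sum_home' (F : 'I_(d + d) -> nat) :
      (\sum_(i in ~: [set i | home i]) F i = \sum_(l < d) F (rshift d l))%N.
    rewrite big_mkcond big_split_ord /= big1 ?add0n => [|l _].
      by apply: eq_bigr => l _; rewrite !inE home_r.
    by rewrite !inE home_l.
  have wa : weight a = (\sum_(i in [set i | home i]) z i)%N.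
    by rewrite sum_home; apply: eq_bigr => l _; rewrite z_l.
  have wb : weight b = (\sum_(i in ~: [set i | home i]) z i)%N.
    by rewrite sum_home'; apply: eq_bigr => l _; rewrite z_r.
  have sumC (Q : {set 'I_(d + d)}) :
      (\sum_(i in Q) z i + \sum_(i in ~: Q) z i = \sum_i z i)%N.
    rewrite [RHS](bigID (mem Q)) /=; congr (_ + _)%N.
    by apply: eq_bigl => i; rewrite inE.
  split; last by rewrite wa wb !sumC.
  have [i0 home0 nf0] : exists2 i, home i & ~~ f i.
    apply/exists_inP; rewrite -negb_forall_in; apply: contra neq_f => /forall_inP sub.
    have /eqP E : [set i | home i] == P.
      rewrite eqEcard cP card_home leqnn andbT.
      by apply/subsetP => i; rewrite !inE; exact: sub.
    by apply/eqP/ffunP => i; move/setP/(_ i): E; rewrite !inE ffunE => ->.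
  (* The threshold b_k separates the exchanged rows: those leaving the left copy are at most a_k <
     b_k, those entering it are at least b_k. *)
  pose th := entry b k : nat.
  have z_home i : home i -> ~~ f i -> (z i < th)%N.
    move=> hi nfi; move: (okf i); rewrite /ok hi (negPf nfi) /=.
    case: (split_ordP i) hi => l ->; rewrite ?home_r // z_l dbl_l => _ le_lk.
    exact: leq_ltn_trans (entry_le a le_lk) lt_ab.
  have z_nhome i : ~~ home i -> f i -> (th <= z i)%N.
    move=> hi fi; move: (okf i); rewrite /ok (negPf hi) fi /=.
    case: (split_ordP i) hi => l ->; rewrite ?home_l // z_r dbl_r => _.
    exact: entry_le.
  have sum_card (Q : pred 'I_(d + d)) : #|[set i | Q i]| = d ->
      (\sum_i Q i * th = d * th)%N.
    move=> cQ; rewrite -big_distrl -sum1_card big_mkcond /= in cQ *; congr (_ * _)%N.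
    by rewrite -[RHS]cQ; apply: eq_bigr => i _; rewrite inE; case: (Q i).
  have sum_mem (Q : pred 'I_(d + d)) :
      (\sum_(i in [set i | Q i]) z i = \sum_i Q i * z i)%N.
    by rewrite big_mkcond; apply: eq_bigr => i _; rewrite inE; case: (Q i); rewrite ?mul1n.
  (* As [f] and [home] both select [d] rows, [d * th] can be spread over [f] on one side and over
     [home] on the other. The comparison then becomes termwise, and it is strict at [i0]. *)
  rewrite wa !sum_mem -(ltn_add2r (d * th)).
  rewrite -[X in (X < _)%N](congr1 (addn _) (sum_card f cP)).
  rewrite -(sum_card home card_home) -!big_split /=.
  rewrite (bigD1 i0) // [ltnRHS](bigD1 i0) //= -addSn leq_add //.
    by rewrite home0 (negPf nf0) !mul1n !mul0n addn0; exact: z_home.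
  apply: leq_sum => i _; case: (boolP (home i)) (z_home i) (z_nhome i); case: (f i) => //=;
    rewrite ?mul1n ?mul0n ?addn0 ?add0n //.
    by move=> _ /(_ isT isT)/ltnW.
  by move=> _ _ /(_ isT isT).
have /fin_all_exists[x xP] := termP.
exists {ffun 'I_(d + d) -> bool}.
exists (fun f => (x f).1), (fun f => (x f).2.1), (fun f => (x f).2.2).
split=> [f|A]; first by case: (xP f).
under eq_bigr do rewrite -(proj2 (xP _)).
rewrite (bigD1 (finfun home)) //= eqxx add0r.
move: (det0 A); rewrite (bigD1 (finfun home)) //= => /eqP; rewrite addr_eq0 => /eqP E.
rewrite (eq_bigr (fun f => - \det (N A f))) => [|f /negPf-> //].
(* For the distribution [home] the matrix is block diagonal, with the minors of [a] and [b] as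
   blocks. *)
rewrite sumrN -E -(det_ublock _ 0); congr (\det _).
apply/matrixP => i j; rewrite [RHS]mxE ffunE.
case: (split_ordP i) => l ->; case: (split_ordP j) => m ->.
- by rewrite block_mxEul home_l row_mxEl !mxE /ok home_l z_l.
- by rewrite block_mxEur home_l row_mxEr !mxE.
- by rewrite block_mxEdl home_r row_mxEl !mxE.
- by rewrite block_mxEdr home_r row_mxEr !mxE /ok home_r z_r.
Qed.

End Straightening.

(** * Plücker coordinates and Schubert conditions *)

Lemma card_ord_lt m k : (k <= m)%N -> #|[set l : 'I_m | (l < k)%N]| = k.
Proof.
move=> le_km; rewrite cardsE -sum1_card.
by rewrite (big_ord_narrow le_km) sum1_card card_ord.
Qed.

Lemma card_ord_ge m k : (k <= m)%N -> #|[set l : 'I_m | (k <= l)%N]| = (m - k)%N.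
Proof.
move=> le_km; rewrite -[in RHS](card_ord m) -(cardsC [set l : 'I_m | (l < k)%N]).
rewrite card_ord_lt // addKn; congr #|pred_of_set _|.
by apply/setP => l; rewrite !inE -leqNgt.
Qed.

Section Vanishing.
Variables (K : fieldType) (d n : nat).

(* [Vlow t] and [Vupp t] are instances of this definition by conversion. *)
Definition coordinate_space m (P : pred 'I_m) : {vspace 'cV[K]_m} :=
  <<[seq (delta_mx j 0%R : 'cV[K]_m) | j : 'I_m <- enum 'I_m & P j]>>%VS.

Lemma coordinate_spaceP m (P : pred 'I_m) (u : 'cV[K]_m) :
  reflect (forall j, ~~ P j -> u j 0 = 0) (u \in coordinate_space P).
Proof.
apply: (iffP idP) => [uP j nPj | u0].
  pose f (x : 'cV[K]_m) : K^o := x j 0.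
  have f_lin : linear f by move=> c x y; rewrite /f !mxE.
  pose fL := GRing.isLinear.Build _ _ _ _ f f_lin.
  pose F : {linear 'cV[K]_m -> K^o} := HB.pack f fL.
  have sub : (coordinate_space P <= lker (linfun F))%VS.
    apply/span_subvP => x /mapP[i]; rewrite mem_filter => /andP[Pi _] ->.
    rewrite memv_ker lfunE /= /f mxE eqxx andbT.
    by case: (j =P i) nPj => [->|_ _]; rewrite ?Pi ?eqxx.
  by have := subvP sub _ uP; rewrite memv_ker lfunE => /eqP.
have -> : u = \sum_j u j 0 *: delta_mx j 0.
  rewrite [LHS]matrix_sum_delta; apply: eq_bigr => j _.
  by rewrite big_ord1.
apply: rpred_sum => j _; case: (boolP (P j)) => [Pj | /u0->]; last first.
  by rewrite scale0r rpred0.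
by apply: rpredZ; apply: memv_span; apply: map_f; rewrite mem_filter Pj mem_enum.
Qed.

Lemma dim_coordinate_space m (P : pred 'I_m) :
  (\dim (coordinate_space P) <= #|[set j | P j]|)%N.
Proof.
apply: leq_trans (dim_span _) _.
by rewrite size_map cardsE cardE enumT /enum_mem size_filter.
Qed.

Lemma colspanP (A : 'M[K]_(n, d)) (u : 'cV[K]_n) :
  u \in colspan A -> exists c, u = A *m c.
Proof.
have /subvP sub : (colspan A <= limg (linfun (mulmx A : 'cV_d -> 'cV_n)))%VS.
  apply/span_subvP => _ /mapP[k _ ->].
  have -> : col k A = linfun (mulmx A : 'cV_d -> 'cV_n) (delta_mx k 0).
    by rewrite lfunE /= colE.
  by rewrite memv_img ?memvf.
by move=> /sub/memv_imgP[c _ ->]; exists c; rewrite lfunE.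
Qed.

(* Extracting the rows [s] is injective on the column span and maps its vectors
   supported in [P] to vectors supported in [P o s]. *)
Lemma dim_capv_coordinate_space (A : 'M[K]_(n, d)) (s : 'I_d -> 'I_n) P :
  \det (rowsub s A) != 0 ->
  (\dim (colspan A :&: coordinate_space P) <= #|[set k | P (s k)]|)%N.
Proof.
move=> nz_det; apply: leq_trans (dim_coordinate_space (P \o s)).
pose f : {linear 'cV[K]_n -> 'cV[K]_d} := rowsub s.
rewrite -(@limg_dim_eq _ _ _ (linfun f)).
  apply: dimvS; apply/subvP => _ /memv_imgP[u /memv_capP[_ /coordinate_spaceP uP] ->].
  by apply/coordinate_spaceP => k nPk; rewrite lfunE /= mxE uP.
apply/eqP; rewrite -subv0; apply/subvP => u.
rewrite memv_cap memv_ker lfunE /= memv0 => /andP[/memv_capP[/colspanP[c ->] _]].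
rewrite /f /= => /eqP E.
have : rowsub s A *m c = 0 by rewrite mul_rowsub_mx.
move/(congr1 (mulmx (invmx (rowsub s A)))); rewrite mulKmx ?mulmx0 => [->|].
  by rewrite mulmx0.
by rewrite unitmxE unitfE.
Qed.

(** If s_k > w_k, the entries of [s] that are at most w_k sit in positions below [k]. A nonzero
    minor would then bound the intersection dimension by [k], where the Schubert condition asks for
    [k + 1]. *)
Lemma plucker_Schubert0 (w s : Idn d n) (A : 'M[K]_(n, d)) :
  Schubert w (colspan A) -> ~~ leI s w -> plucker A s = 0.
Proof.
move=> /andP[_ /forallP/= dimU] /forallPn[k]; rewrite -ltnNge => lt_wsk.
apply/eqP; apply: contraTT (dimU k) => nz; rewrite -ltnNge ltnS.
pose P (j : 'I_n) := (j < (entry w k).+1)%N.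
apply: leq_trans (dim_capv_coordinate_space P nz) _.
have <- : #|[set l : 'I_d | (l < k)%N]| = k.
  by rewrite card_ord_lt // ltnW.
apply: subset_leq_card; apply/subsetP => l; rewrite !inE /P ltnS => le_slw.
rewrite ltnNge; apply: contraL le_slw => le_kl; rewrite -ltnNge.
exact: leq_trans lt_wsk (entry_le _ le_kl).
Qed.

(** The mirror argument. The condition at [rev_ord k] concerns the vectors supported in rows from
    v_k on; if s_k < v_k, only the [rev_ord k] positions after [k] can have s_l >= v_k. *)
Lemma plucker_opp_Schubert0 (v s : Idn d n) (A : 'M[K]_(n, d)) :
  opp_Schubert v (colspan A) -> ~~ leI v s -> plucker A s = 0.
Proof.
move=> /andP[_ /forallP/= dimU] /forallPn[k]; rewrite -ltnNge => lt_svk.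
apply/eqP; apply: contraTT (dimU (rev_ord k)) => nz; rewrite rev_ordK -ltnNge ltnS.
pose P (j : 'I_n) := (n - (n - entry v k) <= j)%N.
apply: leq_trans (dim_capv_coordinate_space P nz) _.
rewrite /P subKn ?(ltnW (ltn_ord _)) //.
have <- : #|[set l : 'I_d | (k < l)%N]| = rev_ord k.
  by rewrite card_ord_ge.
apply: subset_leq_card; apply/subsetP => l; rewrite !inE => le_vsl.
rewrite ltnNge; apply: contraL le_vsl => le_lk; rewrite -ltnNge.
exact: leq_ltn_trans (entry_le _ le_lk) lt_svk.
Qed.

(** The minor on the rows [w] makes the columns independent. Columns up to [k] are supported in rows
    up to w_k, and columns from [k] on in rows from v_k on; counting columns gives both families of
    bounds. *)
Lemma Richardson_band (w v : Idn d n) (A : 'M[K]_(n, d)) :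
  (forall j k, A j k != 0 -> (entry v k <= j <= entry w k)%N) ->
  plucker A w != 0 -> Richardson w v (colspan A).
Proof.
move=> band nz.
have freeA : free [seq col k A | k <- enum 'I_d].
  apply/(@freeP _ _ d (map_tuple (fun k => col k A) (ord_tuple d))) => c Ac0 k.
  have Ac : A *m (\col_l c l) = 0.
    rewrite -[RHS]Ac0; apply/colP => j; rewrite mxE summxE; apply: eq_bigr => l _.
    by rewrite -tnth_nth tnth_map tnth_ord_tuple !mxE mulrC.
  have : rowsub (entry w) A *m (\col_l c l) = 0 by rewrite mul_rowsub_mx Ac raddf0.
  move/(congr1 (mulmx (invmx (rowsub (entry w) A)))); rewrite mulmx0 mulKmx.
    by move/colP/(_ k); rewrite !mxE.
  by rewrite unitmxE unitfE.
have dim_sub (Q : pred 'I_d) P : (forall k j, Q k -> ~~ P j -> A j k = 0) ->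
    (#|[set k | Q k]| <= \dim (colspan A :&: coordinate_space P))%N.
  move=> QP; pose X := [seq col k A | k <- enum 'I_d & Q k].
  have freeX : free X.
    apply: (@catl_free _ _ [seq col k A | k <- enum 'I_d & predC Q k]).
    rewrite -map_cat (perm_free (Y := [seq col k A | k <- enum 'I_d])) //.
    by apply: perm_map; rewrite perm_filterC.
  have -> : #|[set k | Q k]| = size X.
    by rewrite size_map cardsE cardE enumT /enum_mem size_filter.
  move: freeX; rewrite /free => /eqP<-; apply: dimvS; apply/span_subvP => x /mapP[k].
  rewrite mem_filter => /andP[Qk _] ->; rewrite memv_cap; apply/andP; split.
    by apply: memv_span; apply/mapP; exists k; rewrite ?mem_enum.
  by apply/coordinate_spaceP => j nPj; rewrite mxE (QP _ _ Qk).
have gr : Grassmannian d (colspan A).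
  by move: freeA; rewrite /free size_map size_enum_ord.
apply/andP; split; (apply/andP; split=> //); apply/forallP => k.
  apply: leq_trans (dim_sub (fun l => (l <= k)%N) _ _) => [|l j le_lk].
    by rewrite (@card_ord_lt d k.+1).
  rewrite ltnS -ltnNge => lt_wj; apply/eqP; apply: contraTT lt_wj => /band/andP[_ le_jw].
  by rewrite -leqNgt (leq_trans le_jw) // entry_le.
apply: leq_trans (dim_sub (fun l => (rev_ord k <= l)%N) _ _) => [|l j le_kl].
  by rewrite card_ord_ge /= ?leq_subr // subKn.
rewrite subKn ?(ltnW (ltn_ord _)) // -ltnNge => lt_jv; apply/eqP.
apply: contraTT lt_jv => /band/andP[le_vj _].
by rewrite -leqNgt (leq_trans _ le_vj) // entry_le.
Qed.

End Vanishing.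

(** * Linear spans of indexed families *)

Section LinearSpan.
Variables (K : fieldType) (V : lmodType K) (T : eqType) (P : pred T) (b : T -> V).

Definition in_span (x : V) := exists (ts : seq T) (c : T -> K),
  all P ts /\ x = \sum_(t <- ts) c t *: b t.

Lemma in_span0 : in_span 0.
Proof. by exists [::], (fun=> 0); rewrite big_nil. Qed.

Lemma in_span_gen t : P t -> in_span (b t).
Proof.
by move=> Pt; exists [:: t], (fun=> 1); rewrite /= Pt big_seq1 scale1r.
Qed.

Lemma in_spanZ a x : in_span x -> in_span (a *: x).
Proof.
move=> [ts [c [Pts ->]]]; exists ts, (fun t => a * c t); split=> //.
by rewrite scaler_sumr; apply: eq_bigr => t _; rewrite scalerA.
Qed.

(** Adding two combinations requires a single coefficient per index; repetitions in a list are
    therefore turned into multiplicities over a common duplicate-free list. *)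
Lemma sum_undup_count (ts us : seq T) (f : T -> V) : {subset ts <= us} ->
  uniq us -> \sum_(t <- ts) f t = \sum_(t <- us) f t *+ count_mem t ts.
Proof.
move=> sub us_uniq; elim: ts sub => [|t ts IH] sub.
  by rewrite big_nil big1_seq.
rewrite big_cons IH => [|u tsu]; last by rewrite sub // inE tsu orbT.
have tus : t \in us by rewrite sub ?mem_head.
rewrite [RHS](bigD1_seq t) //= eqxx add1n mulrS -addrA; congr (_ + _).
rewrite [LHS](bigD1_seq t) //=; congr (_ + _).
by apply: eq_bigr => u; rewrite eq_sym => /negPf->.
Qed.

Lemma in_spanD x y : in_span x -> in_span y -> in_span (x + y).
Proof.
move=> [ts [c [Pts ->]]] [us [e [Pus ->]]].
have uniq_tu := undup_uniq (ts ++ us).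
exists (undup (ts ++ us)), (fun t => c t *+ count_mem t ts + e t *+ count_mem t us).
split; first by rewrite all_undup all_cat Pts.
rewrite (@sum_undup_count ts (undup (ts ++ us))) // => [|t tst]; last first.
  by rewrite mem_undup mem_cat tst.
rewrite (@sum_undup_count us (undup (ts ++ us))) // => [|t ust]; last first.
  by rewrite mem_undup mem_cat ust orbT.
rewrite -big_split; apply: eq_bigr => t _ /=.
by rewrite scalerDl !scalerMnl.
Qed.

Lemma in_span_sum (I : Type) (r : seq I) (Q : pred I) (F : I -> V) :
  (forall i, Q i -> in_span (F i)) -> in_span (\sum_(i <- r | Q i) F i).
Proof.
by move=> spF; apply: big_ind => //; [exact: in_span0 | exact: in_spanD].
Qed.

End LinearSpan.

Lemma unsorted_split (T : Type) (e : rel T) (s : seq T) : ~~ sorted e s ->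
  exists s1 a b s2, s = s1 ++ [:: a, b & s2] /\ ~~ e a b.
Proof.
elim: s => // a [|b s] // IH /=; rewrite negb_and => /orP[nab|/IH].
  by exists [::], a, b, s.
by move=> [s1 [x [y [s2 [-> nxy]]]]]; exists (a :: s1), x, y, s2.
Qed.

(** * Standard monomials span *)

Section Spanning.
Variables (K : fieldType) (d n : nat).

(* Strictly increases when weight moves to an earlier factor. *)
Fixpoint height (s : seq (Idn d n)) : nat :=
  if s is a :: s' then (size s * weight a + height s')%N else 0.

(** The factor [a] counts once more than its right neighbour, so with the total weight of the pair
    fixed, the height grows by [weight a' - weight a]. *)
Lemma height_exchange s1 s2 (a b a' b' : Idn d n) : (weight a < weight a')%N ->
  (weight a' + weight b' = weight a + weight b)%N ->
  (height (s1 ++ [:: a, b & s2]) < height (s1 ++ [:: a', b' & s2]))%N.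
Proof.
move=> lt_aa' eq_ab; elim: s1 => [|x s1 IH] /=; last by rewrite !size_cat ltn_add2l.
by move: (size s2) => m; nia.
Qed.

(** Straightening keeps the number of factors, so this bound stays constant along the rewriting and
    forces it to stop. *)
Lemma height_bound s : (height s <= size s ^ 2 * (d * n))%N.
Proof.
elim: s => //= a s IH.
have : (weight a <= d * n)%N.
  rewrite -[d in (_ <= d * _)%N]card_ord -sum_nat_const.
  by apply: leq_sum => k _; exact: ltnW.
by move: (size s) (weight a) (d * n)%N IH => m x y; nia.
Qed.

Variable X : pred {vspace 'cV[K]_n}.

Lemma meval_plucker_var (A : 'M[K]_(n, d)) (s : Idn d n) :
  (plucker_var K s).@[fun k => plucker A (enum_val k)] = plucker A s.
Proof. by rewrite mevalXU enum_rankK. Qed.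

(** An identity valid at every matrix gives an element of the vanishing ideal of any [X]. *)
Lemma plucker_coord_relation (a b : Idn d n) (T : finType) (c : T -> K)
    (a' b' : T -> Idn d n) :
  (forall A : 'M[K]_(n, d), plucker A a * plucker A b =
      \sum_f c f * (plucker A (a' f) * plucker A (b' f))) ->
  plucker_coord X a * plucker_coord X b =
    \sum_f c f *: (plucker_coord X (a' f) * plucker_coord X (b' f)).
Proof.
move=> rel; rewrite -rmorphM.
under eq_bigr do rewrite -rmorphM -linearZ.
rewrite -raddf_sum; apply/to_coord_ring_eq; apply/asboolP => U _ _ A _.
rewrite mevalB mevalM !meval_plucker_var rel; apply/eqP; rewrite subr_eq0; apply/eqP.
rewrite raddf_sum; apply: eq_bigr => f _.
by rewrite /= mevalZ mevalM !meval_plucker_var.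
Qed.

Lemma plucker_monomialE (s : seq (Idn d n)) :
  plucker_monomial X s = to_coord_ring X (\prod_(a <- s) plucker_var K a).
Proof. by rewrite rmorph_prod. Qed.

Lemma meval_monomial (A : 'M[K]_(n, d)) (s : seq (Idn d n)) :
  (\prod_(a <- s) plucker_var K a).@[fun k => plucker A (enum_val k)]
    = \prod_(a <- s) plucker A a.
Proof. by rewrite rmorph_prod; apply: eq_bigr => a _; exact: meval_plucker_var. Qed.

Lemma plucker_monomial0 (s : seq (Idn d n)) :
  (forall A : 'M[K]_(n, d), X (colspan A) -> \prod_(a <- s) plucker A a = 0) ->
  plucker_monomial X s = 0.
Proof.
move=> s0; rewrite plucker_monomialE -(raddf0 (to_coord_ring X)).
apply/to_coord_ring_eq; rewrite subr0; apply/asboolP => U _ XU A AU.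
by rewrite meval_monomial s0 // AU.
Qed.

(** Induction on [gap], the distance of the height to its bound: exchanging a non-standard adjacent
    pair decreases it in every term with nonzero coefficient. *)
Lemma monomial_straighten (P : pred (seq (Idn d n))) :
  (forall s, standard s -> in_span P (plucker_monomial X) (plucker_monomial X s)) ->
  forall s, in_span P (plucker_monomial X) (plucker_monomial X s).
Proof.
move=> Pstd s; pose gap s := (size s ^ 2 * (d * n) - height s)%N.
move: {2}(gap s).+1 (ltnSn (gap s)) => k; elim: k s => // k IH s; rewrite ltnS => gap_s.
have [/Pstd // | /unsorted_split] := boolP (standard s).
move=> [s1 [a [b [s2 [Es /(straighten_pair K) [T [c [a' [b' [wab rel]]]]]]]]]].
have -> : plucker_monomial X s =
    \sum_f c f *: plucker_monomial X (s1 ++ [:: a' f, b' f & s2]).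
  rewrite Es /plucker_monomial big_cat !big_cons /= [X in _ * X = _]mulrA.
  rewrite (plucker_coord_relation rel) mulr_suml mulr_sumr; apply: eq_bigr => f _.
  rewrite -coord_scaleAl mulrC -coord_scaleAl mulrC.
  by rewrite big_cat !big_cons /= (mulrA (plucker_coord X _)).
apply: in_span_sum => f _.
have [->|/wab[lt_a eq_ab]] := eqVneq (c f) 0; first by rewrite scale0r; exact: in_span0.
apply/in_spanZ/IH; apply: leq_trans gap_s.
have := height_exchange s1 s2 lt_a eq_ab.
have := height_bound (s1 ++ [:: a' f, b' f & s2]).
by rewrite /gap Es !size_cat /=; lia.
Qed.

Lemma plucker_monomials_span (P : pred (seq (Idn d n))) :
  (forall s, standard s -> in_span P (plucker_monomial X) (plucker_monomial X s)) ->
  forall x : coord_ring d X, in_span P (plucker_monomial X) x.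
Proof.
move=> Pstd x; have [f <-] := to_coord_ring_surj x.
rewrite (mpolyE f) raddf_sum; apply: in_span_sum => m _ /=.
rewrite linearZ; apply: in_spanZ.
suff [s Es] : exists s, to_coord_ring X 'X_[m] = plucker_monomial X s.
  rewrite [Y in in_span _ _ Y](_ : _ = plucker_monomial X s) //.
  exact: monomial_straighten.
rewrite mpolyXE_id rmorph_prod.
apply: (big_ind (fun x => exists s, x = plucker_monomial X s)).
- by exists [::]; rewrite /plucker_monomial big_nil.
- by move=> _ _ [s ->] [t ->]; exists (s ++ t); rewrite /plucker_monomial big_cat.
move=> i _; exists (nseq (m i) (enum_val i)).
rewrite /plucker_monomial big_nseq rmorphXn /plucker_coord /plucker_var enum_valK.
by rewrite -Monoid.iteropE.
Qed.

End Spanning.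

Lemma standard_Richardson0 (K : fieldType) d n (w v : Idn d n) s (A : 'M[K]_(n, d)) :
  standard s -> ~~ standard_on w v s -> Richardson w v (colspan A) ->
  \prod_(a <- s) plucker A a = 0.
Proof.
rewrite /standard_on => -> /=; case: s => // a s.
rewrite negb_and => nwv /andP[wU vU]; apply/eqP; rewrite prodf_seq_eq0.
case/orP: nwv => [nwa | nvl]; apply/hasP.
  by exists a; rewrite ?inE ?eqxx //=; apply/eqP; exact: plucker_Schubert0 wU nwa.
exists (last a s); rewrite ?mem_last //=; apply/eqP.
exact: plucker_opp_Schubert0 vU nvl.
Qed.

(** * Degrees of minors and independence of standard monomials *)

Lemma digits_inj B E (F G : nat -> nat) :
  (forall e, F e < B)%N -> (forall e, G e < B)%N ->
  (\sum_(e < E) F e * B ^ e = \sum_(e < E) G e * B ^ e)%N ->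
  forall e, (e < E)%N -> F e = G e.
Proof.
elim: E F G => // E IH F G ltF ltG.
have shift (H : nat -> nat) :
    (\sum_(e < E.+1) H e * B ^ e = H 0 + (\sum_(e < E) H e.+1 * B ^ e) * B)%N.
  rewrite big_ord_recl muln1 big_distrl; congr (_ + _)%N.
  by apply: eq_bigr => e _; rewrite /= /bump add1n expnSr mulnA.
have B_gt0 : (0 < B)%N by exact: leq_ltn_trans (ltF 0%N).
rewrite !shift => eqFG.
have eq0 : F 0%N = G 0%N.
  by move/(congr1 (modn^~ B)): eqFG; rewrite /= ![(_ + _ * B)%N]addnC !modnMDl !modn_small.
move: eqFG; rewrite eq0 => /addnI/eqP; rewrite eqn_pmul2r // => /eqP eqS.
case=> [|e] lt_eE //.
by apply: (IH (F \o succn) (G \o succn)) => // i; [exact: ltF | exact: ltG].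
Qed.

(** Triangularity: by induction from the largest size down, the leading position of [g t] receives
    nothing from smaller sizes, and larger ones already have coefficient 0. *)
Lemma monic_independent (K : fieldType) (T : eqType) (g : T -> {poly K})
    (ts : seq T) (c : T -> K) : uniq ts -> {in ts, forall t, g t \is monic} ->
  {in ts &, injective (fun t => size (g t))} ->
  \sum_(t <- ts) c t *: g t = 0 -> {in ts, forall t, c t = 0}.
Proof.
move=> uniq_ts mon inj sum0.
pose M := \max_(t <- ts) size (g t).
have leM t : t \in ts -> (size (g t) <= M)%N by move=> tts; exact: leq_bigmax_seq.
suff H k t : t \in ts -> (M - size (g t) < k)%N -> c t = 0 by move=> t /H; apply.
elim: k t => // k IH t tts lt_k.
move/(congr1 (fun p : {poly K} => p`_(size (g t)).-1)): sum0.
rewrite coef_sum coef0 (bigD1_seq t) //= coefZ -lead_coefE (monicP (mon t tts)) mulr1.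
rewrite big_seq_cond big1 ?addr0 // => u /andP[uts neq_ut].
rewrite coefZ; case: (ltngtP (size (g u)) (size (g t))) => [lt_ut|lt_tu|eq_ut].
- by rewrite nth_default ?mulr0 //; move: lt_ut; case: (size (g t)).
- by rewrite IH ?mul0r //; move: lt_k (leM u uts); lia.
- by rewrite (inj _ _ uts tts eq_ut) eqxx in neq_ut.
Qed.

Section Band.
Variables (d n : nat).

(** The degree of the diagonal term of the minor on rows [s] of [band_mx]. *)
Definition expo B (s : Idn d n) := (\sum_(k < d) B ^ (entry s k * d + k))%N.

(** Let [k] be the largest index moved by [p]. Beyond [k] the terms agree; up to [k] the left side
    has at most [d < B] powers of [B], all with exponent below that of the [k]-th term of
    [expo B s]. *)
Lemma expo_perm B (s : Idn d n) (p : {perm 'I_d}) : (d < B)%N -> p != 1%g ->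
  (\sum_(k < d) B ^ (entry s k * d + p k) < expo B s)%N.
Proof.
move=> lt_dB p_neq1; have B_gt0 : (0 < B)%N by case: B lt_dB.
have [k0 k0P] : exists k, p k != k.
  apply/existsP; rewrite -negb_forall; apply: contra p_neq1 => /forallP pE.
  by apply/eqP/permP => k; rewrite perm1; apply/eqP; exact: pE.
case: (@arg_maxnP _ k0 (fun k => p k != k) val k0P) => k pk max_k.
have fix_gt (l : 'I_d) : (k < l)%N -> p l = l.
  by move=> lt_kl; apply/eqP/negPn; apply: contraTN lt_kl => /max_k; rewrite -leqNgt.
have le_p (l : 'I_d) : (l <= k)%N -> (p l <= k)%N.
  move=> le_lk; rewrite leqNgt; apply: contraTN (le_lk) => lt_kpl.
  by rewrite -ltnNge -{1}(perm_inj (fix_gt _ lt_kpl)).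
have lt_pk : (p k < k)%N by rewrite ltn_neqAle le_p // andbT.
have bound (l : 'I_d) : (l <= k)%N -> (entry s l * d + p l <= (entry s k * d + k).-1)%N.
  rewrite leq_eqVlt => /predU1P[/val_inj->|lt_lk]; first by lia.
  have := entry_lt s lt_lk; have := ltn_ord (p l); have := le_p l (ltnW lt_lk).
  by nia.
rewrite /expo (bigID (fun l : 'I_d => l <= k)%N) [ltnRHS](bigID (fun l : 'I_d => l <= k)%N) /=.
rewrite [X in (_ + X < _)%N](eq_bigr (fun l : 'I_d => B ^ (entry s l * d + l))%N); last first.
  by move=> l; rewrite -ltnNge => /fix_gt->.
rewrite ltn_add2r [ltnRHS](bigD1 k) //=.
apply: leq_trans (leq_addr _ _).
apply: (@leq_ltn_trans (\sum_(l < d) B ^ (entry s k * d + k).-1)%N).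
  rewrite big_mkcond leq_sum // => l _; case: ifP => // /bound le_b.
  by rewrite leq_pexp2l.
rewrite sum_nat_const card_ord.
have -> : (entry s k * d + k = (entry s k * d + k).-1.+1)%N by lia.
by rewrite [X in (_ < X)%N]expnS ltn_pmul2r // expn_gt0 B_gt0.
Qed.

Lemma geI_trans : transitive (@geI d n).
Proof.
move=> b a c /forallP ab /forallP bc; apply/forallP => k.
exact: leq_trans (bc k) (ab k).
Qed.

Lemma geI_refl : reflexive (@geI d n).
Proof. by move=> a; apply/forallP. Qed.

Lemma standard_on_between (w v : Idn d n) s a : standard_on w v s -> a \in s ->
  leI v a && leI a w.
Proof.
case: s => // b s /andP[/= std /andP[wb lv]] abs; apply/andP; split.
  suff : geI a (last b s) by move/geI_trans; exact.
  elim: s a b std abs {wb lv} => [|c s IH] a b /= => [_|/andP[bc cs]].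
    by rewrite inE => /eqP->; exact: geI_refl.
  rewrite inE => /predU1P[->|acs]; last exact: IH.
  by apply: geI_trans bc _; apply: IH; rewrite ?mem_head.
move: abs; rewrite inE => /predU1P[-> //|a_s].
by apply: geI_trans wb _; exact: (allP (order_path_min geI_trans std)).
Qed.

(** The digit at place j d + k counts the factors whose [k]-th entry is [j]. *)
Lemma expo_digits B (s : seq (Idn d n)) :
  (\sum_(a <- s) expo B a =
   \sum_(e < n * d) (\sum_(a <- s) \sum_(k < d) (entry a k * d + k == e)) * B ^ e)%N.
Proof.
under [RHS]eq_bigr do rewrite big_distrl.
rewrite [RHS]exchange_big; apply: eq_bigr => a _ /=.
under [RHS]eq_bigr do rewrite big_distrl.
rewrite [RHS]exchange_big; apply: eq_bigr => k _ /=.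
have lt_e : (entry a k * d + k < n * d)%N.
  by have := ltn_ord (entry a k); have := ltn_ord k; nia.
rewrite (bigD1 (Ordinal lt_e)) //= eqxx mul1n big1 ?addn0 // => e.
by rewrite -val_eqE eq_sym => /negPf /= ->.
Qed.

(* Equal exponents have equal base-B digits, i.e. the two tableaux have the same
   content in each column. *)
Lemma expo_inj B (s t : seq (Idn d n)) : (0 < d)%N ->
  (size s * d < B)%N -> (size t * d < B)%N -> standard s -> standard t ->
  (\sum_(a <- s) expo B a = \sum_(a <- t) expo B a)%N -> s = t.
Proof.
move=> d_gt0 ltsB lttB std_s std_t; rewrite !expo_digits => eq_st.
pose F (u : seq (Idn d n)) e := (\sum_(a <- u) \sum_(k < d) (entry a k * d + k == e))%N.
(* Each factor adds at most [d] to a digit, so there are no carries. *)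
have F_lt u e : (size u * d < B)%N -> (F u e < B)%N.
  apply: leq_ltn_trans; rewrite -sum1_size big_distrl leq_sum //= => a _.
  rewrite mul1n -[leqRHS]card_ord -sum1_card leq_sum // => k _.
  exact: leq_b1.
have eqF := digits_inj (F_lt s ^~ ltsB) (F_lt t ^~ lttB) eq_st.
have F_count u (j : 'I_n) (k : 'I_d) :
    F u (j * d + k)%N = count_mem j [seq entry a k | a <- u].
  rewrite count_map -sum1_count big_mkcond; apply: eq_bigr => a _ /=.
  rewrite (bigD1 k) //= big1 ?addn0 => [|l neq_lk].
    by rewrite eqn_add2r eqn_pmul2r // val_eqE; case: eqP.
  apply/eqP; rewrite eqb0; apply: contra neq_lk => /eqP/(congr1 (modn^~ d)).
  by rewrite /= !modnMDl !modn_small // => /val_inj->.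
(* The columns of a standard tableau are weakly decreasing, so their content determines them. *)
have col_eq k : [seq entry a k | a <- s] = [seq entry a k | a <- t].
  pose ge (x y : 'I_n) := (y <= x)%N.
  have ge_tr : transitive ge by move=> y x z xy yz; exact: leq_trans yz xy.
  have ge_anti : antisymmetric ge by move=> x y; rewrite andbC => /anti_leq/val_inj.
  have srt u : standard u -> sorted ge [seq entry a k | a <- u].
    rewrite sorted_map; apply: sub_sorted => a b /forallP; exact.
  apply: (sorted_eq ge_tr ge_anti (srt s std_s) (srt t std_t)).
  apply/allP => j _ /=; rewrite -!F_count eqF //.
  by have := ltn_ord j; have := ltn_ord k; nia.
elim: s t col_eq {ltsB lttB std_s std_t eq_st eqF} => [|a s IH] [|b t] //= col_eq.
(* Column 0, which exists since [d > 0], detects a difference in length. *)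
- by have := col_eq (Ordinal d_gt0).
- by have := col_eq (Ordinal d_gt0).
congr (_ :: _); last by apply: IH => k; case: (col_eq k).
by apply/val_inj/eq_from_tnth => k; case: (col_eq k).
Qed.

Variable K : fieldType.

Definition band_mx B (w v : Idn d n) : 'M[{poly K}]_(n, d) :=
  \matrix_(j, k) if (entry v k <= j <= entry w k)%N then 'X^(B ^ (j * d + k)) else 0.

(** A non-identity permutation either meets an entry outside the band, which is zero, or has smaller
    degree by [expo_perm]. *)
Lemma band_minor B (w v s : Idn d n) : (d < B)%N -> leI v s -> leI s w ->
  \det (rowsub (entry s) (band_mx B w v)) \is monic /\
  size (\det (rowsub (entry s) (band_mx B w v))) = (expo B s).+1.
Proof.
move=> lt_dB /forallP vs /forallP sw.
have main : \prod_k (rowsub (entry s) (band_mx B w v)) k k = 'X^(expo B s).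
  rewrite -prodrXr; apply: eq_bigr => k _.
  by rewrite !mxE vs sw.
rewrite /determinant (bigD1 1%g) //= odd_perm1 mul1r.
under eq_bigr do rewrite perm1.
rewrite main; set r := \sum_(p | _) _.
have size_r : (size r < size ('X^(expo B s) : {poly K}))%N.
  rewrite size_polyXn ltnS; apply: leq_trans (size_sum _ _ _) _.
  apply/bigmax_leqP => p neq_p1; rewrite size_Msign.
  have [/forallP Z | /forallPn[k nk]] :=
      boolP [forall k : 'I_d, (entry v (p k) <= entry s k <= entry w (p k))%N].
    rewrite (eq_bigr (fun k : 'I_d => 'X^(B ^ (entry s k * d + p k)))) => [|k _].
      by rewrite prodrXr size_polyXn expo_perm.
    by rewrite !mxE Z.
  by rewrite (bigD1 k) //= !mxE (negPf nk) mul0r size_poly0.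
by rewrite monicE lead_coefDl // lead_coefXn eqxx size_polyDl // size_polyXn.
Qed.

Lemma plucker_band B (w v s : Idn d n) (x : K) :
  plucker (map_mx (horner_eval x) (band_mx B w v)) s =
  (\det (rowsub (entry s) (band_mx B w v))).[x].
Proof. by rewrite /plucker -map_mxsub det_map_mx. Qed.

End Band.

Lemma standard_monomials_independent (K : closedFieldType) d n (w v : Idn d n)
    (ts : seq (seq (Idn d n))) (c : seq (Idn d n) -> K) :
  (0 < d)%N -> geI w v -> uniq ts -> all (standard_on w v) ts ->
  (forall A : 'M[K]_(n, d), Richardson w v (colspan A) ->
     \sum_(t <- ts) c t * \prod_(a <- t) plucker A a = 0) ->
  {in ts, forall t, c t = 0}.
Proof.
move=> d_gt0 wv uniq_ts /allP std_ts vanish.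
(* [B] exceeds [d], as [expo_perm] asks, and every [size t * d], as [expo_inj] asks. *)
pose B := (maxn d (\max_(t <- ts) (size t * d))).+1.
have lt_dB : (d < B)%N by rewrite ltnS leq_maxl.
have lt_tB t : t \in ts -> (size t * d < B)%N.
  by move=> tts; rewrite ltnS leq_max; apply/orP; right; exact: leq_bigmax_seq.
pose M : 'M[{poly K}]_(n, d) := band_mx K B w v.
pose g t := \prod_(a <- t) \det (rowsub (entry a) M).
have gP t : t \in ts -> g t \is monic /\ size (g t) = (\sum_(a <- t) expo B a).+1.
  move/std_ts; move=> /standard_on_between bt; rewrite /g.
  elim: t bt => [|a t IH] bt; first by rewrite !big_nil monic1 size_poly1.
  have [|mon_t size_t] := IH; first by move=> b bt'; rewrite bt // inE bt' orbT.
  have /andP[va aw] := bt a (mem_head _ _).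
  have [mon_a size_a] := band_minor K lt_dB va aw.
  by rewrite !big_cons monicMl // size_monicM ?monic_neq0 // size_a size_t addSn /= addnS.
apply: (@monic_independent K _ g) => // [t /gP[] // | s t sts tts | ].
  rewrite (proj2 (gP s sts)) (proj2 (gP t tts)) => -[].
  by apply: expo_inj; rewrite ?lt_tB //; [case/andP: (std_ts s sts)|case/andP: (std_ts t tts)].
set Q := \sum_(t <- ts) _; apply/eqP; apply: contraT => nzQ.
have [mon_w _] := band_minor K lt_dB wv (geI_refl w).
(* If [Q] were nonzero, some [x] in the algebraically closed field would avoid the roots of both [Q]
   and the minor on rows [w]. The second makes the matrix at [x] a point of the Richardson variety,
   where [Q] must vanish. *)
have [x] : exists x, ~~ root (Q * \det (rowsub (entry w) M)) x.
  by apply/closed_nonrootP; rewrite mulf_neq0 // monic_neq0.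
rewrite rootM negb_or => /andP[Qx wx].
pose A := map_mx (horner_eval x) M.
case/negP: Qx; apply/eqP; rewrite horner_sum -[RHS](vanish A).
  apply: eq_bigr => t _; rewrite hornerZ horner_prod; congr (_ * _).
  by apply: eq_bigr => a _; rewrite plucker_band.
apply: Richardson_band => [j k|]; last by rewrite plucker_band.
by rewrite !mxE; case: ifP => // _; rewrite horner_evalE horner0 eqxx.
Qed.

Theorem theorem4p2p1 (K : closedFieldType) (d n r : nat)
    (hd : (1 <= d)%N) (hdn : (d < n)%N)
    (w v : 'I_r -> Idn d n) (hwv : forall i : 'I_r, geI (w i) (v i)) :
  is_basis (standard_on_union w v)
    (plucker_monomial (union_Richardson K w v)).
Proof.
split=> [ts c uniq_ts /allP std_ts sum0 t0 t0ts | x].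
  have /existsP[i t0i] := std_ts t0 t0ts.
  (* Restriction to the [i]-th Richardson variety kills the monomials that are not standard on it,
     so only the others are kept; [t0] is among them. *)
  apply: (@standard_monomials_independent K d n (w i) (v i)
            [seq t <- ts | standard_on (w i) (v i) t] c) => //.
  - exact: filter_uniq.
  - exact: filter_all.
  - move=> A RA; rewrite big_filter.
    move: sum0; rewrite (eq_bigr (fun t => to_coord_ring (union_Richardson K w v)
        (c t *: \prod_(a <- t) plucker_var K a))) => [|t _]; last first.
      by rewrite linearZ plucker_monomialE.
    rewrite -raddf_sum -(raddf0 (to_coord_ring _)) => /to_coord_ring_eq.
    rewrite subr0 => /asboolP/(_ (colspan A))/=.
    have UA : union_Richardson K w v (colspan A) by apply/existsP; exists i.
    have GA : Grassmannian d (colspan A) by case/andP: RA => /andP[].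
    move=> /(_ GA UA A erefl); rewrite raddf_sum /= => sum0.
    rewrite -[RHS]sum0 [RHS](bigID (standard_on (w i) (v i))) /=.
    rewrite [X in _ = _ + X]big1_seq ?addr0 => [|t /andP[nst tts]].
      by apply: eq_bigr => t _; rewrite mevalZ meval_monomial.
    rewrite mevalZ meval_monomial (standard_Richardson0 _ nst RA) ?mulr0 //.
    by have /existsP[j /andP[]] := std_ts t tts.
  - by rewrite mem_filter t0i.
apply: plucker_monomials_span => s std_s.
have [|nst] := boolP (standard_on_union w v s); first exact: in_span_gen.
(* For [r = 0] this includes the empty sequence: the union is empty, so even the monomial 1 is
   zero. *)
rewrite plucker_monomial0; first exact: in_span0.
move=> A /existsP[i RA]; apply: standard_Richardson0 std_s _ RA.
by apply: contra nst => st; apply/existsP; exists i.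
Qed.
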